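(* Suppose $pn\to\infty$ and $q\ln n\to\infty$ as $n\to\infty$, where $q=1-p$. Then for every $\varepsilon>0$ there exists $n_0$ such that for all $n\ge n_0$, $$u_3(n,p)\le(2+\varepsilon)\log_{\frac{1}{1-p}}(np)\quad\text{and}\quad u_3'(n,p)\le(2+\varepsilon)\log_{\frac{1}{1-p}}(np).$$
   Context: $G(n,p)$ is the Erdős–Rényi random graph on $n$ labelled vertices (vertex set $V$), each edge present independently with probability $p=p(n)$; $\mathbb{P}_{n,p}$ is the corresponding probability and $q=1-p$. A diameter graph in $\mathbb{R}^d$ is a graph $(V,E)$ with $V\subset\mathbb{R}^d$ finite and $E=\{\{\mathbf{x},\mathbf{y}\}\subseteq V: |\mathbf{x}-\mathbf{y}|=\operatorname{diam}V\}$, where $\operatorname{diam}V=\max_{\mathbf{x},\mathbf{y}\in V}|\mathbf{x}-\mathbf{y}|$ (Euclidean norm); a graph is a diameter graph in $\mathbb{R}^d$ if it is isomorphic to one. $u_d(n,p)$ is the largest positive integer $k$ such that $\mathbb{P}_{n,p}\big(\exists W\subseteq V,\ |W|=k,\ G[W]$ is a diameter graph in $\mathbb{R}^d$ and $\chi(G[W])=d+1\big)>\frac12$, where $G[W]$ is the induced subgraph; if no such $k$ exists, $u_d(n,p)=0$. $u_d'(n,p)$ is defined identically with the additional requirement that $G[W]$ be connected. *)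

(* Defs.v *)
From Stdlib Require Import Reals ClassicalEpsilon.
From mathcomp Require Import all_boot.
Set Implicit Arguments. Unset Strict Implicit. Unset Printing Implicit Defensive.

Definition pb (P : Prop) : bool := if excluded_middle_informative P then true else false.

Definition point (d : nat) := 'I_d -> R.
Definition dist d (x y : point d) : R :=
  sqrt (\big[Rplus/R0]_(i < d) Rsqr (Rminus (x i) (y i))).

Definition pairs n : {set {set 'I_n}} := [set e : {set 'I_n} | #|e| == 2].
Definition edge n (G : {set {set 'I_n}}) (x y : 'I_n) : bool :=
  (x != y) && ([set x; y] \in G).

Definition diam_graph_induced d n (G : {set {set 'I_n}}) (W : {set 'I_n}) : Prop :=
  exists (f : 'I_n -> point d) (D : R),
    {in W &, injective f} /\
    (forall x y, x \in W -> y \in W -> Rle (dist (f x) (f y)) D) /\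
    (exists x y, x \in W /\ y \in W /\ dist (f x) (f y) = D) /\
    (forall x y, x \in W -> y \in W -> x != y ->
       (edge G x y <-> dist (f x) (f y) = D)).

Definition colorable n (G : {set {set 'I_n}}) (W : {set 'I_n}) (k : nat) : Prop :=
  exists c : 'I_n -> nat,
    (forall x, x \in W -> c x < k) /\
    (forall x y, x \in W -> y \in W -> edge G x y -> c x <> c y).

Definition chromatic_number_is n (G : {set {set 'I_n}}) (W : {set 'I_n}) (k : nat) : Prop :=
  colorable G W k /\ (forall j, j < k -> ~ colorable G W j).

Definition induced_connected n (G : {set {set 'I_n}}) (W : {set 'I_n}) : bool :=
  [forall x in W, forall y in W,
     connect (fun a b => [&& a \in W, b \in W & edge G a b]) x y].

Definition prob n (p : R) (Q : {set {set 'I_n}} -> Prop) : R :=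
  \big[Rplus/R0]_(G in powerset (pairs n) | pb (Q G))
     Rmult (pow p #|G|) (pow (Rminus R1 p) (#|pairs n| - #|G|)).

Definition good_event d n (conn : bool) (k : nat) (G : {set {set 'I_n}}) : Prop :=
  exists W : {set 'I_n},
    #|W| = k /\ diam_graph_induced d G W /\ chromatic_number_is G W d.+1 /\
    (conn -> induced_connected G W).

(* largest positive k with P(event) > 1/2, or 0 if none.  Only k <= n need be
   considered: for k > n there is no W with |W| = k, so the probability is 0. *)
Definition u_gen (conn : bool) d n (p : R) : nat :=
  \max_(k < n.+1 | pb (0 < k /\ Rlt (Rinv 2) (prob p (@good_event d n conn k)))) k.

Definition u d n p := u_gen false d n p.
Definition u' d n p := u_gen true d n p.

Definition logb (b x : R) : R := Rdiv (ln x) (ln b).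

(* Main.v *)
From Stdlib Require Import Reals Lra Psatz Classical ClassicalEpsilon FunctionalExtensionality.
From HB Require Import structures.
From mathcomp Require Import all_boot.
Require Import Defs.
Set Implicit Arguments. Unset Strict Implicit. Unset Printing Implicit Defensive.
Local Open Scope R_scope.

(* A diameter graph in R^3 has linearly many edges, and the expected number of
   k-sets of G(n,p) spanning O(k) edges tends to 0 when k > (2 + eps) log_{1/q}(np).

   Linear edge bound: scale the diameter to 1 and consider the oriented edges (a, b)
   whose unit vector u = a - b lies in a fixed octant.  Fix a and a coordinate axis i,
   and order the lower neighbours of a by longitude around the axis.  If u lies strictly
   between u1 and u2, then l u1 + m u2 = al e_i + be u with l, m >= 0.  For every other
   upper neighbour a' = b + u' of b, the condition |u_j + u' - u| <= 1 gives
   u_j . (u' - t u) < 0 with t = u . u', hence al (u'_i - t u_i) < 0.  So the sign of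
   u'_i - t u_i does not depend on a'.  If it is negative, u has the strictly largest
   i-th coordinate at b; and it cannot be positive for all three i, because
   t = sum u_i u'_i > t sum u_i^2 = t is absurd.  Thus every edge is extremal at a for
   some axis (at most 4 per axis and vertex) or maximal at b for some axis (at most 1).

   First moment: P(e(W) <= Ck) <= s^(-Ck) (q + s p)^(k(k-1)/2), with s of order
   q ln(1/q) / p, so that q + s p <= q^(1 - delta) while 1/s is only O(ln(np)). *)

Lemma pbP (P : Prop) : reflect P (pb P).
Proof. by rewrite /pb; case: excluded_middle_informative => h; constructor. Qed.

(** * Unit vectors: tangential inequalities and the order by longitude *)

Lemma dot_lt1 (x y z x' y' z' : R) :
  x * x + y * y + z * z = 1 -> x' * x' + y' * y' + z' * z' = 1 ->
  ~ (x = x' /\ y = y' /\ z = z') -> x * x' + y * y' + z * z' < 1.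
Proof.
move=> h h' ne; apply: Rnot_le_lt => le1; apply: ne.
have sq0 (a : R) : a * a <= 0 -> a = 0 by move=> h0; apply: Rsqr_0_uniq; apply: Rle_antisym; [exact: h0|exact: Rle_0_sqr].
have sx := Rle_0_sqr (x - x'); have sy := Rle_0_sqr (y - y'); have sz := Rle_0_sqr (z - z').
rewrite /Rsqr in sx sy sz.
have hx : x - x' = 0 by apply: sq0; lra.
have hy : y - y' = 0 by apply: sq0; lra.
have hz : z - z' = 0 by apply: sq0; lra.
by lra.
Qed.

(** With v = (a, b, c), the distance hypothesis expands to v.u' - v.u <= t - 1. Hence v.(u' - t u)
    <= (1 - t)(v.u - 1), a positive factor times a negative one. *)
Lemma geodesic_side (x y z x' y' z' a b c : R) :
  x * x + y * y + z * z = 1 -> x' * x' + y' * y' + z' * z' = 1 ->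
  a * a + b * b + c * c = 1 ->
  (a + x' - x) * (a + x' - x) + (b + y' - y) * (b + y' - y)
    + (c + z' - z) * (c + z' - z) <= 1 ->
  ~ (x = x' /\ y = y' /\ z = z') -> ~ (a = x /\ b = y /\ c = z) ->
  let t := x * x' + y * y' + z * z' in
  a * (x' - t * x) + b * (y' - t * y) + c * (z' - t * z) < 0.
Proof.
move=> hu hu' hv far neq neqv t.
have t1 : t < 1 by apply: dot_lt1.
have s1 : a * x + b * y + c * z < 1 by apply: dot_lt1.
have : (a * x' + b * y' + c * z') - (a * x + b * y + c * z) <= t - 1 by rewrite /t; lra.
by nra.
Qed.

(* Monotone in the longitude of (x, y, z) around the x-axis; at the pole y = z = 0
   it is 0 / 0 = 0. *)
Definition lon (y z : R) := y / (y + z).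

Lemma lonE (y z : R) : 0 <= y -> 0 <= z ->
  y = lon y z * (y + z) /\ z = (1 - lon y z) * (y + z) /\ 0 <= lon y z <= 1
    /\ (y + z = 0 -> lon y z = 0).
Proof.
move=> hy hz; rewrite /lon.
case: (Req_dec (y + z) 0) => e.
  have y0 : y = 0 by lra.
  have z0 : z = 0 by lra.
  by rewrite y0 z0 /Rdiv Rmult_0_l; lra.
have p : 0 < y + z by lra.
have q : 0 < / (y + z) by apply: Rinv_0_lt_compat.
have E : (y + z) * / (y + z) = 1 by field.
by rewrite /Rdiv; split; [|split; [|split; [split|]]]; nra.
Qed.

(* Lexicographically in (longitude, x), so that ties on a meridian are broken too;
   in a tie, between_combination holds with al = 0. *)
Definition between (x y z x1 y1 z1 x2 y2 z2 : R) : Prop :=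
  (lon y1 z1 < lon y z < lon y2 z2) \/
  (lon y1 z1 = lon y z /\ lon y z = lon y2 z2 /\ x1 < x < x2).

Lemma between_combination (x y z x1 y1 z1 x2 y2 z2 : R) :
  0 <= x -> 0 <= y -> 0 <= z -> 0 <= x1 -> 0 <= y1 -> 0 <= z1 ->
  0 <= x2 -> 0 <= y2 -> 0 <= z2 ->
  x * x + y * y + z * z = 1 -> x1 * x1 + y1 * y1 + z1 * z1 = 1 ->
  x2 * x2 + y2 * y2 + z2 * z2 = 1 ->
  between x y z x1 y1 z1 x2 y2 z2 ->
  exists l m al be, 0 <= l /\ 0 <= m /\ 0 < l + m /\
    l * x1 + m * x2 = al + be * x /\ l * y1 + m * y2 = be * y /\
    l * z1 + m * z2 = be * z.
Proof.
rewrite /between => hx hy hz hx1 hy1 hz1 hx2 hy2 hz2.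
have [ey [ez [lb nz]]] := lonE hy hz.
have [ey1 [ez1 [lb1 nz1]]] := lonE hy1 hz1.
have [ey2 [ez2 [lb2 nz2]]] := lonE hy2 hz2.
move: (lon y z) (lon y1 z1) (lon y2 z2) ey ez lb nz ey1 ez1 lb1 nz1 ey2 ez2 lb2 nz2 => f f1 f2.
have: 0 <= y + z by lra. have: 0 <= y1 + z1 by lra. have: 0 <= y2 + z2 by lra.
move: (y + z) (y1 + z1) (y2 + z2) => p p1 p2 hp2 hp1 hp.
move=> -> -> lb nz -> -> lb1 nz1 -> -> lb2 nz2 n0 n1 n2 [lt|[e1 [e2 ltx]]]; last subst f1 f2.
  (* The longitude is 0 at a pole, whereas [f] and [f2] each exceed another longitude and so are
     positive; only [p1] may vanish. *)
  have p_gt0 : 0 < p by case: (Req_dec p 0) => [/nz|]; lra.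
  have p2_gt0 : 0 < p2 by case: (Req_dec p2 0) => [/nz2|]; lra.
  (* Projected along the first axis the vectors are p (f, 1 - f). These weights make the combination
     of the outer two proportional to the middle one, and [al] absorbs the rest of the first
     coordinate. *)
  exists (p2 * (f2 - f)), (p1 * (f - f1)),
    (p2 * (f2 - f) * x1 + p1 * (f - f1) * x2 - p1 * p2 * (f2 - f1) / p * x),
    (p1 * p2 * (f2 - f1) / p).
  have q : p1 * p2 * (f2 - f1) / p * p = p1 * p2 * (f2 - f1) by field; lra.
  have a1 : 0 < p2 * (f2 - f) by apply: Rmult_lt_0_compat; lra.
  have a2 : 0 <= p1 * (f - f1) by apply: Rmult_le_pos; lra.
  split; [lra|split; [lra|split; [lra|split; [lra|]]]].
  set r := _ / p in q *.
  by split; nra.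
have w : 0 < f * f + (1 - f) * (1 - f) by nra.
(* Unit vectors on a common meridian satisfy s^2 + w r^2 = 1 with the same w > 0, so r falls as s
   grows. *)
have p_lt (s s' r r' : R) : 0 <= s -> s < s' -> 0 <= r -> 0 <= r' ->
    s * s + f * r * (f * r) + (1 - f) * r * ((1 - f) * r) = 1 ->
    s' * s' + f * r' * (f * r') + (1 - f) * r' * ((1 - f) * r') = 1 -> r' < r.
  move=> s0 ss r0 r0' e e'; apply: Rnot_le_lt => rr.
  have : (f * f + (1 - f) * (1 - f)) * (r' * r' - r * r) < 0 by nra.
  have : 0 <= r' * r' - r * r by nra.
  by nra.
have pp1 : p < p1 by apply: (p_lt x1 x); lra.
have pp2 : p2 < p by apply: (p_lt x x2); lra.
have k_gt0 : 0 < x2 * p1 - x1 * p2 by nra.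
(* The three vectors lie in the plane of the meridian; the weights come from Cramer's rule in the
   coordinates (x, p). *)
exists (x2 * p - x * p2), (x * p1 - x1 * p), 0, (x2 * p1 - x1 * p2).
have l_gt0 : 0 < x2 * p - x * p2 by nra.
have m_gt0 : 0 < x * p1 - x1 * p by nra.
by do 5 (split; [lra|]); lra.
Qed.

(** The longitude fixes the direction of (y, z) in the quadrant, and the norm fixes its length. *)
Lemma lon_inj (y z y' z' : R) : 0 <= y -> 0 <= z -> 0 <= y' -> 0 <= z' ->
  y * y + z * z = y' * y' + z' * z' -> lon y z = lon y' z' -> y = y' /\ z = z'.
Proof.
move=> hy hz hy' hz' e f.
have [ey [ez [lb _]]] := lonE hy hz.
have [ey' [ez' _]] := lonE hy' hz'.
have p0 : 0 <= y + z by lra.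
have p0' : 0 <= y' + z' by lra.
rewrite -f in ey' ez'.
move: (lon y z) (y + z) (y' + z') ey ez lb ey' ez' p0 p0' {f} => f p p' ey ez lb ey' ez' p0 p0'.
suff pp : p = p' by rewrite ey ez ey' ez' pp.
rewrite ey ez ey' ez' in e.
have w : 0 < f * f + (1 - f) * (1 - f) by clear -lb; nra.
have : (f * f + (1 - f) * (1 - f)) * (p * p) = (f * f + (1 - f) * (1 - f)) * (p' * p') by lra.
move/Rmult_eq_reg_l => q; apply: Rsqr_inj => //; apply: q; lra.
Qed.

(** * Counting the edges of one octant *)

Section Octant.
Variables (T : finType) (W : {set T}) (E : {set T * T}).
Implicit Types (X Y Z : T -> R).

(** Coordinates are three separate functions so that axes can be permuted and signs flipped. A pair
    [(a, b)] of [E] runs from the upper endpoint [a] to the lower endpoint [b]. *)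
Definition octant_edges X Y Z : Prop :=
  [/\ {in W &, forall a b, X a = X b -> Y a = Y b -> Z a = Z b -> a = b},
      {in W &, forall a b, (X a - X b) * (X a - X b) + (Y a - Y b) * (Y a - Y b)
                           + (Z a - Z b) * (Z a - Z b) <= 1}
    & forall a b, (a, b) \in E -> a \in W /\ b \in W /\
        0 <= X a - X b /\ 0 <= Y a - Y b /\ 0 <= Z a - Z b /\
        (X a - X b) * (X a - X b) + (Y a - Y b) * (Y a - Y b)
        + (Z a - Z b) * (Z a - Z b) = 1].

Lemma octant_edges_rot X Y Z : octant_edges X Y Z -> octant_edges Y Z X.
Proof.
move=> [inj far up]; split=> [a b aW bW ? ? ?|a b aW bW|a b /up]; first exact: inj.
- by have := far a b aW bW; lra.
- by move=> [? [? [? [? [? ?]]]]]; do 5 (split; first by []); lra.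
Qed.

Definition longitude_inner X Y Z (e : T * T) : Prop :=
  exists b1 b2, (e.1, b1) \in E /\ (e.1, b2) \in E /\
    between (X e.1 - X e.2) (Y e.1 - Y e.2) (Z e.1 - Z e.2)
            (X e.1 - X b1) (Y e.1 - Y b1) (Z e.1 - Z b1)
            (X e.1 - X b2) (Y e.1 - Y b2) (Z e.1 - Z b2).

Lemma card_not_longitude_inner X Y Z : octant_edges X Y Z ->
  (#|[set e in E | ~~ pb (longitude_inner X Y Z e)]| <= 4 * #|W|)%N.
Proof.
move=> [inj _ up].
(* The two bits say whether b is minimal in longitude, and in x on its meridian;
   among non-inner pairs they determine b. *)
pose lo (a b : T) := lon (Y a - Y b) (Z a - Z b).
pose B1 (e : T * T) := pb (forall b, (e.1, b) \in E -> lo e.1 e.2 <= lo e.1 b).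
pose B2 (e : T * T) := pb (forall b, (e.1, b) \in E -> lo e.1 e.2 = lo e.1 b ->
   X e.1 - X e.2 <= X e.1 - X b).
pose F e := (e.1, (B1 e, B2 e)).
have Finj : {in [set e in E | ~~ pb (longitude_inner X Y Z e)] &, injective F}.
  move=> [a b] [a' b']; rewrite !inE => /andP[eE /pbP ne] /andP[eE' /pbP ne'].
  move=> [aa]; subst a'; rewrite /B1 /B2 /= => h1 h2.
  have Elo : lo a b = lo a b'.
    case: (pbP (forall c, _ -> lo a b <= _)) h1 => [m /esym/pbP m'|m /esym/pbP m'].
      by apply: Rle_antisym; [exact: m|exact: m'].
    (* If [c] is not minimal, some neighbour has smaller longitude; one of larger longitude would
       then make [c] inner. So [c] is maximal. *)
    have max c d : (a, c) \in E -> ~ longitude_inner X Y Z (a, c) ->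
        ~ (forall c', (a, c') \in E -> lo a c <= lo a c') ->
        (a, d) \in E -> lo a d <= lo a c.
      move=> cE ni nm dE; apply: Rnot_lt_le => lt; apply: nm => c' cE'.
      by apply: Rnot_lt_le => lt'; apply: ni; exists c', d; split=> //; split=> //; left.
    by apply: Rle_antisym; apply: max.
  have EX : X a - X b = X a - X b'.
    case: (pbP (forall c, _ -> lo a b = _ -> _)) h2 => [m /esym/pbP m'|m /esym/pbP m'].
      by apply: Rle_antisym; [exact: m|exact: m'].
    have max c d : (a, c) \in E -> ~ longitude_inner X Y Z (a, c) ->
        ~ (forall c', (a, c') \in E -> lo a c = lo a c' -> X a - X c <= X a - X c') ->
        (a, d) \in E -> lo a c = lo a d -> X a - X d <= X a - X c.
      move=> cE ni nm dE cd; apply: Rnot_lt_le => lt; apply: nm => c' cE' cc'.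
      by apply: Rnot_lt_le => lt'; apply: ni; exists c', d; split=> //; split=> //; right.
    by apply: Rle_antisym; apply: max.
  have [aW [bW [x0 [y0 [z0 n0]]]]] := up _ _ eE.
  have [_ [bW' [x0' [y0' [z0' n0']]]]] := up _ _ eE'.
  have [||||||ey ez] := @lon_inj (Y a - Y b) (Z a - Z b) (Y a - Y b') (Z a - Z b') => //.
    by rewrite EX in n0; lra.
  by congr pair; apply: inj => //; lra.
rewrite -(card_in_imset Finj).
have -> : (4 * #|W|)%N = #|setX W [set: bool * bool]|.
  by rewrite cardsX cardsT card_prod card_bool mulnC.
apply: subset_leq_card; apply/subsetP => _ /imsetP[[a b] + ->].
by rewrite !inE => /andP[/up [aW _] _]; rewrite /= aW.
Qed.

Definition upper_max X (e : T * T) : Prop :=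
  forall a, (a, e.2) \in E -> a != e.1 -> X a < X e.1.

(** Two strict maximisers above the same [b] would each exceed the other, so [b] determines the
    edge. *)
Lemma card_upper_max X Y Z : octant_edges X Y Z ->
  (#|[set e in E | pb (upper_max X e)]| <= #|W|)%N.
Proof.
move=> [_ _ up].
have sinj : {in [set e in E | pb (upper_max X e)] &, injective snd}.
  move=> [a b] [a' b']; rewrite !inE /= => /andP[eE /pbP t] /andP[eE' /pbP t'] bb.
  subst b'; congr pair; apply/eqP/negPn/negP => ne.
  have := t' a eE ne; rewrite eq_sym in ne; have := t a' eE' ne; rewrite /=; lra.
rewrite -(card_in_imset sinj).
apply: subset_leq_card; apply/subsetP => _ /imsetP[[a b] + ->].
by rewrite !inE => /andP[/up [_ [bW _]] _].
Qed.

Definition dot X Y Z (a a' b : T) : R :=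
  (X a - X b) * (X a' - X b) + (Y a - Y b) * (Y a' - Y b) + (Z a - Z b) * (Z a' - Z b).

(** The vector u' - t u is orthogonal to u, so its product with l u1 + m u2 = al e_X + be u is [al]
    times its X-coordinate. This product is negative, and [al] does not depend on [a']. *)
Lemma longitude_inner_side X Y Z a b : octant_edges X Y Z -> (a, b) \in E ->
  longitude_inner X Y Z (a, b) ->
  (forall a', (a', b) \in E -> a' != a ->
     X a' - X b < dot X Y Z a a' b * (X a - X b)) \/
  (forall a', (a', b) \in E -> a' != a ->
     dot X Y Z a a' b * (X a - X b) < X a' - X b).
Proof.
move=> [inj far up] abE [b1 [b2 [/= ab1 [ab2 btw]]]].
have [aW [bW [x0 [y0 [z0 n0]]]]] := up _ _ abE.
have [_ [bW1 [x1 [y1 [z1 n1]]]]] := up _ _ ab1.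
have [_ [bW2 [x2 [y2 [z2 n2]]]]] := up _ _ ab2.
have [l [m [al [be [l0 [m0 [lm [ex [ey ez]]]]]]]]] :=
  between_combination x0 y0 z0 x1 y1 z1 x2 y2 z2 n0 n1 n2 btw.
have key a' : (a', b) \in E -> a' != a ->
    al * (X a' - X b - dot X Y Z a a' b * (X a - X b)) < 0.
  move=> abE' aa'.
  have [aW' [_ [x0' [y0' [z0' n0']]]]] := up _ _ abE'.
  (* Since a' - c = (a - c) + (a' - b) - (a - b), the diameter bound on [a'] and [c] is the distance
     hypothesis of [geodesic_side]. *)
  have side c : c \in W ->
      (X a - X c) * (X a - X c) + (Y a - Y c) * (Y a - Y c) + (Z a - Z c) * (Z a - Z c) = 1 ->
      ~ (X a - X c = X a - X b /\ Y a - Y c = Y a - Y b /\ Z a - Z c = Z a - Z b) ->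
      let t := dot X Y Z a a' b in
      (X a - X c) * (X a' - X b - t * (X a - X b))
      + (Y a - Y c) * (Y a' - Y b - t * (Y a - Y b))
      + (Z a - Z c) * (Z a' - Z b - t * (Z a - Z b)) < 0.
    move=> cW nc ne; apply: geodesic_side => //.
      by have := far a' c aW' cW; lra.
    move=> [e1 [e2 e3]]; move/eqP: aa'; apply; apply: inj => //; lra.
  have s1 := side b1 bW1 n1; have s2 := side b2 bW2 n2.
  have {}s1 := s1 ltac:(by case: btw => [|[_ [_ ?]]] => [lt [_ [e2 e3]]|[e1 _]]; [rewrite e2 e3 in lt|]; lra).
  have {}s2 := s2 ltac:(by case: btw => [|[_ [_ ?]]] => [lt [_ [e2 e3]]|[e1 _]]; [rewrite e2 e3 in lt|]; lra).
  move: s1 s2 => /=.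
  set t := dot _ _ _ _ _ _ => s1 s2.
  have tE : t = dot X Y Z a a' b by [].
  rewrite /dot in tE.
  move: (X a - X b) (Y a - Y b) (Z a - Z b) (X a' - X b) (Y a' - Y b) (Z a' - Z b)
    (X a - X b1) (Y a - Y b1) (Z a - Z b1) (X a - X b2) (Y a - Y b2) (Z a - Z b2)
    tE n0 ex ey ez s1 s2 => x y z x' y' z' u1 v1 w1 u2 v2 w2 tE n0 ex ey ez s1 s2.
  have -> : al * (x' - t * x) = l * (u1 * (x' - t * x) + v1 * (y' - t * y) + w1 * (z' - t * z))
      + m * (u2 * (x' - t * x) + v2 * (y' - t * y) + w2 * (z' - t * z)).
    transitivity ((l * u1 + m * u2) * (x' - t * x) + (l * v1 + m * v2) * (y' - t * y)
      + (l * w1 + m * w2) * (z' - t * z)); last by ring.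
    rewrite ex ey ez.
    transitivity (al * (x' - t * x) + be * (x * x' + y * y' + z * z' - t * (x * x + y * y + z * z))).
      by rewrite n0 -tE; ring.
    by ring.
  move: (_ + _) (_ + _) s1 s2 => A B A0 B0; clear -l0 m0 lm A0 B0.
  by case: (Rle_lt_dec l 0) => ?; nra.
case: (Rle_lt_dec al 0) => al0; [right|left] => a' /key {}key /key {}key; nra.
Qed.

Lemma not_upper_max X b a : (a, b) \in E -> ~ upper_max X (a, b) ->
  exists a', [/\ (a', b) \in E, a' != a & X a <= X a'].
Proof.
move=> abE nt; apply: NNPP => nex; apply: nt => a' /= aE' ne.
by apply: Rnot_le_lt => le; apply: nex; exists a'.
Qed.

(** Because t < 1, the other alternative would place every further upper neighbour strictly below
    [a], making [a] the strict maximum. *)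
Lemma longitude_inner_above X Y Z a b : octant_edges X Y Z -> (a, b) \in E ->
  longitude_inner X Y Z (a, b) -> ~ upper_max X (a, b) ->
  forall a', (a', b) \in E -> a' != a -> dot X Y Z a a' b * (X a - X b) < X a' - X b.
Proof.
move=> cfg abE inn nt; case: (longitude_inner_side cfg abE inn) => // low.
have [a'' [aE' ne le]] := not_upper_max abE nt.
have := low a'' aE' ne.
have [inj far up] := cfg.
have [aW [bW [x0 [y0 [z0 n0]]]]] := up _ _ abE.
have [aW' [_ [x0' [y0' [z0' n0']]]]] := up _ _ aE'.
have : dot X Y Z a a'' b < 1.
  apply: dot_lt1 => // -[e1 [e2 e3]]; move/eqP: ne; apply; apply: inj => //; lra.
by nra.
Qed.

(** The constant is 3 (4 + 1): for each axis, four non-inner edges per upper endpoint and one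
    maximal edge per lower endpoint. *)
Lemma card_octant_edges X Y Z : octant_edges X Y Z -> (#|E| <= 15 * #|W|)%N.
Proof.
move=> cX; have cY := octant_edges_rot cX; have cZ := octant_edges_rot cY.
pose N X Y Z := [set e in E | ~~ pb (longitude_inner X Y Z e)].
pose M X := [set e in E | pb (upper_max X e)].
have cover : E \subset N X Y Z :|: N Y Z X :|: N Z X Y :|: (M X :|: M Y :|: M Z).
  apply/subsetP => -[a b] abE; rewrite !inE abE /=.
  case: pbP => // iX; case: pbP => // iY; case: pbP => // iZ /=.
  case: pbP => // tX; case: pbP => // tY; case: pbP => // tZ /=.
  have [a' [aE' ne _]] := not_upper_max abE tX.
  have hX := longitude_inner_above cX abE iX tX aE' ne.
  have hY := longitude_inner_above cY abE iY tY aE' ne.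
  have hZ := longitude_inner_above cZ abE iZ tZ aE' ne.
  have [_ _ up] := cX; have [_ [_ [x0 [y0 [z0 n0]]]]] := up _ _ abE.
  have eY : dot Y Z X a a' b = dot X Y Z a a' b by rewrite /dot; ring.
  have eZ : dot Z X Y a a' b = dot X Y Z a a' b by rewrite /dot; ring.
  rewrite eY in hY; rewrite eZ in hZ; exfalso.
  have tE : dot X Y Z a a' b = dot X Y Z a a' b by [].
  rewrite {2}/dot in tE; move: (dot X Y Z a a' b) tE hX hY hZ => t tE hX hY hZ; move: tE hX hY hZ.
  move: (X a - X b) (Y a - Y b) (Z a - Z b) x0 y0 z0 n0 => x y z x0 y0 z0 n0 tE hX hY hZ.
  (* Coordinates of u may be zero, so each term is only nonnegative; the contradiction with the sum
     0 comes from a positive coordinate, which a unit vector of the octant has. *)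
  have pos s s' : 0 <= s -> t * s < s' -> 0 <= s * (s' - t * s) /\ (0 < s -> 0 < s * (s' - t * s)).
    by move=> s0 lt; split=> *; [apply: Rmult_le_pos|apply: Rmult_lt_0_compat]; lra.
  have [px px'] := pos _ _ x0 hX; have [py py'] := pos _ _ y0 hY; have [pz pz'] := pos _ _ z0 hZ.
  have s0 : x * (X a' - X b - t * x) + y * (Y a' - Y b - t * y) + z * (Z a' - Z b - t * z)
      = t - t * (x * x + y * y + z * z) by rewrite {4}tE; ring.
  rewrite n0 in s0.
  case: x0 => [/px'|x0]; first lra.
  case: y0 => [/py'|y0]; first lra.
  case: z0 => [/pz'|z0]; first lra.
  by rewrite -x0 -y0 -z0 in n0; lra.
apply: leq_trans (subset_leq_card cover) _.
have nX : (#|N X Y Z| <= 4 * #|W|)%N := card_not_longitude_inner cX.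
have nY : (#|N Y Z X| <= 4 * #|W|)%N := card_not_longitude_inner cY.
have nZ : (#|N Z X Y| <= 4 * #|W|)%N := card_not_longitude_inner cZ.
have mX : (#|M X| <= #|W|)%N := card_upper_max cX.
have mY : (#|M Y| <= #|W|)%N := card_upper_max cY.
have mZ : (#|M Z| <= #|W|)%N := card_upper_max cZ.
have U (A B : {set T * T}) : (#|A :|: B| <= #|A| + #|B|)%N by rewrite cardsU leq_subr.
apply: leq_trans (U _ _) _.
apply: (@leq_trans (4 * #|W| + 4 * #|W| + 4 * #|W| + (#|W| + #|W| + #|W|))); last first.
  by rewrite -{4 5 6}[#|W|]mul1n -!mulnDl.
by do !(apply: leq_add || apply: leq_trans (U _ _) _).
Qed.

End Octant.

(** * Diameter graphs in three dimensions have linearly many edges *)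

Definition o0 : 'I_3 := ord0.
Definition o1 : 'I_3 := lift ord0 ord0.
Definition o2 : 'I_3 := lift ord0 (lift ord0 ord0).

Lemma dist3 (x y : point 3) :
  0 <= dist x y /\ dist x y * dist x y = (x o0 - y o0) * (x o0 - y o0) + (x o1 - y o1) * (x o1 - y o1) + (x o2 - y o2) * (x o2 - y o2).
Proof.
rewrite /dist !big_ord_recl big_ord0 /Rsqr; split; first exact: sqrt_pos.
rewrite sqrt_sqrt; last by do 3 (apply: Rplus_le_le_0_compat; first exact: Rle_0_sqr); lra.
by rewrite /o0 /o1 /o2; ring.
Qed.

Lemma point3_ext (x y : point 3) : x o0 = y o0 -> x o1 = y o1 -> x o2 = y o2 -> x = y.
Proof.
move=> e0 e1 e2; apply: functional_extensionality => -[[|[|[|m]]] lt] //.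
- by rewrite (_ : Ordinal lt = o0) //; apply: val_inj.
- by rewrite (_ : Ordinal lt = o1) //; apply: val_inj.
- by rewrite (_ : Ordinal lt = o2) //; apply: val_inj.
Qed.

Definition sgn (b : bool) : R := if b then 1 else -1.

Lemma sgn_ge0 (r : R) : exists b, 0 <= sgn b * r.
Proof. by case: (Rle_lt_dec 0 r) => h; [exists true|exists false]; rewrite /sgn; lra. Qed.

Lemma sgn_sqr b : sgn b * sgn b = 1.
Proof. by case: b; rewrite /sgn; lra. Qed.

Lemma card_bigcup_le (I T : finType) (F : I -> {set T}) m :
  (forall i, #|F i| <= m)%N -> (#|\bigcup_i F i| <= #|I| * m)%N.
Proof.
move=> h; rewrite -sum_nat_const.
apply: (@leq_trans (\sum_i #|F i|)); last by apply: leq_sum => i _; exact: h.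
apply: (big_ind2 (fun (A : {set T}) (k : nat) => #|A| <= k)%N) => [|A k B l hA hB|//].
  by rewrite cards0.
by rewrite cardsU; apply: leq_trans (leq_subr _ _) _; apply: leq_add.
Qed.

Definition induced_pairs n (W : {set 'I_n}) : {set {set 'I_n}} :=
  [set e : {set 'I_n} | e \subset W & #|e| == 2%N].

(** Sign changes move each of the 8 octants to the positive one, where at most 15 edges per vertex
    occur; 8 * 15 = 120. *)
Lemma diameter_graph_size n (G : {set {set 'I_n}}) (W : {set 'I_n}) :
  diam_graph_induced 3 G W -> (#|G :&: induced_pairs W| <= 120 * #|W|)%N.
Proof.
move=> [f [D [inj [far [[x0 [y0 [_ [_ Dxy]]]] edgeE]]]]].
have D0 : 0 <= D by rewrite -Dxy; case: (dist3 (f x0) (f y0)).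
have adj e : e \in G :&: induced_pairs W ->
    exists x y, [/\ x \in W, y \in W, x != y, e = [set x; y] & dist (f x) (f y) = D].
  rewrite !inE => /and3P[eG eW /cards2P[x [y [ne ee]]]]; exists x, y.
  rewrite ee in eW eG; have xW : x \in W by apply: (subsetP eW); rewrite !inE eqxx.
  have yW : y \in W by apply: (subsetP eW); rewrite !inE eqxx orbT.
  by split=> //; apply/edgeE; rewrite ?/edge ?ne.
(* Scaling divides by [D]. If D = 0, an edge would join two vertices at the same point, against
   injectivity. *)
have [Dz|Dp] : D = 0 \/ 0 < D by lra.
  suff -> : G :&: induced_pairs W = set0 by rewrite cards0.
  apply/setP => e; rewrite in_set0; apply/negP => /adj[x [y [xW yW /eqP ne _ d]]].
  apply: ne; apply: inj => //; have [_ dd] := dist3 (f x) (f y).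
  rewrite d Dz in dd.
  have sq0 (a b : R) : (a - b) * (a - b) <= 0 -> a = b.
    by move=> h; apply: Rminus_diag_uniq; apply: Rsqr_0_uniq; apply: Rle_antisym => //; apply: Rle_0_sqr.
  have p0 := Rle_0_sqr (f x o0 - f y o0); have p1 := Rle_0_sqr (f x o1 - f y o1).
  have p2 := Rle_0_sqr (f x o2 - f y o2); rewrite /Rsqr in p0 p1 p2.
  by apply: point3_ext; apply: sq0; lra.
pose X (s : bool) i (a : 'I_n) := sgn s * f a i / D.
have XB s i a b : X s i a - X s i b = sgn s * (f a i - f b i) / D.
  by rewrite /X; field; lra.
have XBsq s i a b : (X s i a - X s i b) * (X s i a - X s i b) = (f a i - f b i) * (f a i - f b i) / (D * D).
  rewrite XB; transitivity (sgn s * sgn s * ((f a i - f b i) * (f a i - f b i)) / (D * D)).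
    by field; lra.
  by rewrite sgn_sqr; field; lra.
have norm s s' s'' a b : (X s o0 a - X s o0 b) * (X s o0 a - X s o0 b)
   + (X s' o1 a - X s' o1 b) * (X s' o1 a - X s' o1 b)
   + (X s'' o2 a - X s'' o2 b) * (X s'' o2 a - X s'' o2 b)
   = dist (f a) (f b) * dist (f a) (f b) / (D * D).
  by rewrite !XBsq; have [_ ->] := dist3 (f a) (f b); field; lra.
pose E (s : bool * bool * bool) := [set e : 'I_n * 'I_n | [&& e.1 \in W, e.2 \in W &
  pb [/\ dist (f e.1) (f e.2) = D, 0 <= X s.1.1 o0 e.1 - X s.1.1 o0 e.2,
     0 <= X s.1.2 o1 e.1 - X s.1.2 o1 e.2 & 0 <= X s.2 o2 e.1 - X s.2 o2 e.2]]].
have cfg s : octant_edges W (E s) (X s.1.1 o0) (X s.1.2 o1) (X s.2 o2).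
  split=> [a b aW bW e0 e1 e2|a b aW bW|a b].
  - apply: inj => //.
    have cancel t i : X t i a = X t i b -> f a i = f b i.
      move=> e; have := XB t i a b; rewrite e Rminus_diag => /esym h.
      apply: Rminus_diag_uniq; apply: (Rmult_eq_reg_l (sgn t * / D)).
        by rewrite Rmult_0_r -h; field; lra.
      apply: Rmult_integral_contrapositive_currified; first by case: (t); rewrite /sgn; lra.
      by apply: Rinv_neq_0_compat; lra.
    by apply: point3_ext; apply: cancel; eassumption.
  - rewrite norm; have := far a b aW bW; have [d0 _] := dist3 (f a) (f b).
    move: (dist _ _) d0 => d d0 dD.
    apply: (Rmult_le_reg_r (D * D)); first by nra.
    rewrite /Rdiv Rmult_assoc Rinv_l; nra.
  - rewrite inE => /and3P[aW bW /pbP[/= d h0 h1 h2]]; do 5 (split; first by []).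
    by rewrite norm d; field; lra.
have cover : G :&: induced_pairs W \subset \bigcup_s [set [set e.1; e.2] | e in E s].
  apply/subsetP => e /adj[x [y [xW yW _ -> d]]].
  have side i : exists s, 0 <= X s i x - X s i y.
    have [s hs] := sgn_ge0 (f x i - f y i); exists s; rewrite XB.
    by apply: Rmult_le_pos => //; left; apply: Rinv_0_lt_compat.
  have [s0 h0] := side o0; have [s1 h1] := side o1; have [s2 h2] := side o2.
  apply/bigcupP; exists (s0, s1, s2) => //; apply/imsetP; exists (x, y) => //.
  by rewrite inE xW yW; apply/pbP.
apply: leq_trans (subset_leq_card cover) _.
rewrite (_ : 120 = #|{: bool * bool * bool}| * 15)%N; last by rewrite !card_prod card_bool.
rewrite -mulnA; apply: card_bigcup_le => s.
exact: leq_trans (leq_imset_card _ _) (card_octant_edges (cfg s)).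
Qed.

(** * Real sums over graphs and the first moment *)

HB.instance Definition _ := Monoid.isComLaw.Build R 0 Rplus
  (fun x y z => esym (Rplus_assoc x y z)) Rplus_comm Rplus_0_l.
HB.instance Definition _ := Monoid.isComLaw.Build R 1 Rmult
  (fun x y z => esym (Rmult_assoc x y z)) Rmult_comm Rmult_1_l.
HB.instance Definition _ := Monoid.isMulLaw.Build R 0 Rmult Rmult_0_l Rmult_0_r.
HB.instance Definition _ := Monoid.isAddLaw.Build R Rmult Rplus
  (fun x y z => Rmult_plus_distr_r x y z) Rmult_plus_distr_l.

Lemma pow_card (T : finType) (A : {set T}) x :
  x ^ #|A| = \big[Rmult/1]_i (if i \in A then x else 1).
Proof.
by rewrite -big_mkcond big_const; elim: #|_| => //= k ->.
Qed.

Lemma sum_le (I : finType) (P : pred I) (F G : I -> R) :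
  (forall i, P i -> F i <= G i) ->
  \big[Rplus/0]_(i | P i) F i <= \big[Rplus/0]_(i | P i) G i.
Proof.
move=> h; apply: (big_ind2 Rle) => //; first exact: Rle_refl.
by move=> *; apply: Rplus_le_compat.
Qed.

Lemma sum_ge0 (I : finType) (P : pred I) (F : I -> R) :
  (forall i, P i -> 0 <= F i) -> 0 <= \big[Rplus/0]_(i | P i) F i.
Proof.
move=> h; apply: big_ind => //; first exact: Rle_refl.
by move=> *; apply: Rplus_le_le_0_compat.
Qed.

Lemma sum_const (I : finType) (A : {set I}) (c : R) :
  \big[Rplus/0]_(i in A) c = INR #|A| * c.
Proof.
rewrite big_const; elim: #|A| => [|k IH]; first by rewrite /= Rmult_0_l.
by rewrite iterS IH S_INR; ring.
Qed.

(** Independence of the pairs turns the sum into a product: a pair in [S] contributes 1 - p + s p,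
    any other pair 1. *)
Lemma edge_generating_function (T : finType) (P S : {set T}) (p s : R) : S \subset P ->
  \big[Rplus/0]_(G in powerset P)
     (p ^ #|G| * (1 - p) ^ (#|P| - #|G|) * s ^ #|G :&: S|) = (1 - p + s * p) ^ #|S|.
Proof.
move=> sSP.
(* The value 0 outside [P] cancels every [G] not contained in [P], so the product can run over the
   whole type. *)
pose F i := if i \in P then (if i \in S then s * p else p) else 0.
pose H i := if i \in P then 1 - p else 1.
transitivity (\big[Rmult/1]_i (F i + H i)); last first.
  rewrite pow_card; apply: eq_bigr => i _; rewrite /F /H.
  case: ifP => iP; case: ifP => iS; try lra.
  by rewrite (subsetP sSP) in iP.
rewrite bigA_distr big_mkcond; apply: eq_bigr => G _.
case: ifP => [|/negbT]; rewrite powersetE => GP; last first.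
  have /subsetPn[i iG iP] := GP.
  by rewrite (bigD1 i) //= iG /F (negbTE iP) Rmult_0_l.
rewrite -(setIidPr GP) -cardsD (setIidPr GP) !pow_card -!big_split.
apply: eq_bigr => i _ /=; rewrite !inE /F /H.
case: ifP => iG /=; last by case: ifP => _; rewrite ?(if_same); lra.
rewrite (subsetP GP) //=; case: ifP => _; lra.
Qed.

(* Markov's inequality for the number of k-sets weighted by s^(edges - m). *)
Lemma prob_first_moment n (p s : R) (k m : nat) (Q : {set {set 'I_n}} -> Prop) :
  0 <= p <= 1 -> 0 < s <= 1 ->
  (forall G, Q G -> exists2 W : {set 'I_n}, #|W| = k & (#|G :&: induced_pairs W| <= m)%N) ->
  prob p Q * s ^ m <= INR 'C(n, k) * (1 - p + s * p) ^ 'C(k, 2%N).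
Proof.
move=> hp hs hQ.
pose w (G : {set {set 'I_n}}) := p ^ #|G| * (1 - p) ^ (#|pairs n| - #|G|).
have w0 G : 0 <= w G by apply: Rmult_le_pos; apply: pow_le; lra.
pose Ws := [set W : {set 'I_n} | #|W| == k].
have cW : #|Ws| = 'C(n, k).
  have := cards_draws [set: 'I_n] k; rewrite cardsT card_ord => <-.
  by apply: eq_card => W; rewrite !inE subsetT.
have sub (W : {set 'I_n}) : induced_pairs W \subset pairs n.
  by apply/subsetP => e; rewrite !inE => /andP[].
have s_le1 j : s ^ j <= 1.
  by rewrite -(pow1 j); apply: pow_incr; lra.
(* As s <= 1, a graph satisfying [Q] has one k-set of weight at least s^m, and the other k-sets
   contribute nonnegative terms. *)
apply: (@Rle_trans _ (\big[Rplus/0]_(G in powerset (pairs n))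
   \big[Rplus/0]_(W in Ws) (w G * s ^ #|G :&: induced_pairs W|))).
  rewrite /prob big_distrl /= big_mkcondr /=; apply: sum_le => G _.
  have t0 (W : {set 'I_n}) : 0 <= w G * s ^ #|G :&: induced_pairs W|.
    by apply: Rmult_le_pos => //; apply: pow_le; lra.
  case: pbP => [/hQ[W Wk Gm]|_]; last by apply: sum_ge0.
  have WW : W \in Ws by rewrite inE Wk.
  rewrite (bigD1 W) //= -[X in X <= _]Rplus_0_r.
  apply: Rplus_le_compat; last by apply: sum_ge0.
  apply: Rmult_le_compat_l; first exact: w0.
  rewrite -(subnK Gm) addnC pow_add -[X in _ <= X]Rmult_1_r.
  by apply: Rmult_le_compat_l => //; apply: pow_le; lra.
rewrite exchange_big /=.
have -> : \big[Rplus/0]_(W in Ws) \big[Rplus/0]_(G in powerset (pairs n))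
     (w G * s ^ #|G :&: induced_pairs W|) = \big[Rplus/0]_(W in Ws) (1 - p + s * p) ^ 'C(k, 2%N).
  apply: eq_bigr => W; rewrite inE => /eqP Wk.
  by rewrite edge_generating_function // cards_draws Wk.
by rewrite sum_const cW; apply: Rle_refl.
Qed.

(** * Elementary estimates for binomials and logarithms *)

Lemma INR_leq m n : (m <= n)%N -> INR m <= INR n.
Proof. by move/leP/le_INR. Qed.

Lemma INR_bin2 k : INR 'C(k, 2%N) = INR k * (INR k - 1) / 2.
Proof.
elim: k => [|k IH]; first by rewrite bin0n /=; lra.
by rewrite binS bin1 -plusE plus_INR IH S_INR; field.
Qed.

(** A weak Stirling bound; the inductive step reduces to (1 + 1/k)^k <= e. *)
Lemma exp_ge_pow_fact k : INR k ^ k <= INR k`! * exp (INR k).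
Proof.
elim: k => [|k IH]; first by rewrite fact0 /= exp_0; lra.
rewrite factS -multE mult_INR -tech_pow_Rmult !S_INR exp_plus.
have k0 := pos_INR k.
suff step : (INR k + 1) ^ k <= INR k`! * exp (INR k) * exp 1.
  by apply: (Rle_trans _ ((INR k + 1) * (INR k`! * exp (INR k) * exp 1))); [apply: Rmult_le_compat_l => //; lra|right; ring].
apply: Rle_trans (Rmult_le_compat_r _ _ _ (Rlt_le _ _ (exp_pos 1)) IH).
case: k k0 {IH} => [|k] k0; first by rewrite /= Rmult_1_l; have := exp_ineq1_le 1; lra.
set m := INR k.+1; have m0 : 0 < m by apply: lt_0_INR; apply/ltP.
have -> : m + 1 = m * (1 + / m) by field; lra.
rewrite Rpow_mult_distr; apply: Rmult_le_compat_l; first by apply: pow_le; lra.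
have -> : exp 1 = exp (/ m) ^ k.+1.
  by rewrite -Rpower_pow ?/Rpower ?ln_exp; [congr exp; rewrite -/m; field; lra|exact: exp_pos].
apply: pow_incr; have := exp_ineq1_le (/ m); have := Rinv_0_lt_compat _ m0; lra.
Qed.

Lemma ffact_le_exp n k : (n ^_ k <= n ^ k)%N.
Proof.
elim: k n => [|k IH] n; first by rewrite ffactn0 expn0.
rewrite ffactnSr expnSr; apply: leq_mul => //; exact: leq_subr.
Qed.

Lemma INR_expn n k : INR (n ^ k)%N = INR n ^ k.
Proof. by elim: k => [|k IH] //; rewrite expnS -multE mult_INR IH. Qed.

(** This is C(n, k) <= n^k / k! <= (e n / k)^k, with [y] standing for any upper bound of n / k. *)
Lemma bin_le n k y : (0 < k)%N -> 0 <= y -> INR n <= INR k * y -> INR 'C(n, k) <= (exp 1 * y) ^ k.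
Proof.
move=> k0 y0 hn.
have F0 : 0 < INR k`! by apply: lt_0_INR; apply/ltP; rewrite fact_gt0.
apply: (Rmult_le_reg_r (INR k`!)) => //.
rewrite -mult_INR multE bin_ffact.
apply: (Rle_trans _ _ _ (INR_leq (ffact_le_exp n k))); rewrite INR_expn.
apply: (Rle_trans _ ((INR k * y) ^ k)); first by apply: pow_incr; split=> //; exact: pos_INR.
rewrite !Rpow_mult_distr.
have -> : exp 1 ^ k = exp (INR k).
  by rewrite -Rpower_pow ?/Rpower ?ln_exp ?Rmult_1_r //; exact: exp_pos.
apply: Rle_trans (Rmult_le_compat_r _ _ _ (pow_le _ k y0) (exp_ge_pow_fact k)) _.
by right; ring.
Qed.

Lemma log_linear_bound (b c d : R) : 0 < b -> 0 < c -> 0 < d ->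
  exists X, forall x, X <= x -> 1 + b * ln (2 * x / d) - c * x <= -1.
Proof.
move=> b0 c0 d0.
(* With v = a (2 x / d) this choice gives b v = c x / 2, so 1 + ln v <= v bounds the logarithm by
   half of the linear term; [X] makes the other half large enough. *)
pose a := c * d / (4 * b).
have a0 : 0 < a by apply: Rdiv_lt_0_compat; nra.
pose X := 2 * (2 - b - b * ln a) / c.
exists (1 + Rabs X) => x hx.
have x1 : 1 <= x by have := Rabs_pos X; lra.
have y0 : 0 < 2 * x / d by apply: Rdiv_lt_0_compat; lra.
have ay0 : 0 < a * (2 * x / d) by nra.
have := exp_ineq1_le (ln (a * (2 * x / d))).
rewrite exp_ln // ln_mult //.
have -> : a * (2 * x / d) = c * x / (2 * b) by rewrite /a; field; lra.
move/(Rmult_le_compat_l b _ _ (Rlt_le _ _ b0)).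
have -> : b * (c * x / (2 * b)) = c * x / 2 by field; lra.
have : X * c <= x * c by apply: Rmult_le_compat_r; [lra|have := Rle_abs X; lra].
have -> : X * c = 2 * (2 - b - b * ln a) by rewrite /X; field; lra.
lra.
Qed.

(** * From the first moment to the threshold *)

(** The asymptotic assumptions enter as explicit inequalities in x = ln(np), valid for large n. *)
Lemma prob_good_event_le n k conn (p eps : R) :
  let x := ln (INR n * p) in let d := eps / (4 + 2 * eps) in
  0 < eps -> 0 < p < 1 -> 0 < INR n -> 1 <= x -> / (1 - p) <= 2 * x ->
  1 + 121 * ln (2 * x / d) - eps / 4 * x <= -1 ->
  (0 < k)%N -> (2 + eps) * x < INR k * ln (/ (1 - p)) ->
  prob p (@good_event 3 n conn k) <= / 2.
Proof.
move=> x d e0 hp n0 x1 hq hx k0 hk.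
have d0 : 0 < d by apply: Rdiv_lt_0_compat; lra.
have d1 : d < 1.
  by rewrite /d; apply: (Rmult_lt_reg_r (4 + 2 * eps)); [lra|field_simplify; lra].
(* [d] is chosen so that replacing q by q^(1 - d) costs half of the surplus [eps]. *)
have dE : (1 - d) * (1 + eps / 2) = 1 + eps / 4 by rewrite /d; field; lra.
set q := 1 - p in hq hk *; have q0 : 0 < q by rewrite /q; lra.
have iq0 : 0 < / q by apply: Rinv_0_lt_compat.
set l := ln (/ q) in hk.
have expl : exp l = / q by rewrite exp_ln.
have qE : q = exp (- l) by rewrite exp_Ropp expl Rinv_inv.
have l_ge : p <= l by have := exp_ineq1_le (- l); rewrite -qE /q; lra.
have l_le : l * q <= p.
  have := exp_ineq1_le l; rewrite expl => /(Rmult_le_compat_r q _ _ (Rlt_le _ _ q0)).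
  by rewrite Rinv_l /q; lra.
have l0 : 0 < l by lra.
(* 1 / s <= 2 x / d = exp L, and also q^-1 <= exp L. *)
set L := ln (2 * x / d) in hx.
have xd0 : 0 < 2 * x / d by apply: Rdiv_lt_0_compat; lra.
have expL : exp L = 2 * x / d by rewrite exp_ln.
have xd_ge : 2 * x <= 2 * x / d.
  apply: (Rmult_le_reg_r d) => //; have -> : 2 * x / d * d = 2 * x by field; lra.
  by nra.
have lL : l <= L.
  by apply: Rnot_lt_le => /exp_increasing; rewrite expl expL; lra.
set K := INR k in hk; have K1 : 1 <= K by apply: (INR_leq k0).
(* This makes q + s p = q (1 + d l) <= q exp(d l) = q^(1 - d). From l q <= p <= l it follows that d
   q <= s <= d. *)
pose s := d * q * l / p.
have s_ge : exp (- L) <= s.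
  rewrite exp_Ropp expL; apply: (Rle_trans _ (d * q)).
    apply: (Rmult_le_reg_r (2 * x / d)) => //; rewrite Rinv_l; last lra.
    have -> : d * q * (2 * x / d) = q * (2 * x) by field; lra.
    by rewrite -(Rinv_r q); [apply: Rmult_le_compat_l; lra|lra].
  rewrite /s; apply: (Rmult_le_reg_r p); first lra.
  have -> : d * q * l / p * p = d * q * l by field; lra.
  by apply: Rmult_le_compat_l; [apply: Rlt_le; apply: Rmult_lt_0_compat|].
have s01 : 0 < s <= 1.
  split; first by have := exp_pos (- L); lra.
  rewrite /s; apply: (Rmult_le_reg_r p); first lra.
  have -> : d * q * l / p * p = d * (l * q) by field; lra.
  by nra.
have base : 1 - p + s * p <= exp (- ((1 - d) * l)).
  have -> : 1 - p + s * p = q * (1 + d * l) by rewrite /s /q; field; lra.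
  have -> : - ((1 - d) * l) = - l + d * l by ring.
  rewrite exp_plus -qE; apply: Rmult_le_compat_l; first lra.
  exact: exp_ineq1_le.
have expk (r : R) j : exp r ^ j = exp (INR j * r).
  by rewrite -Rpower_pow ?/Rpower ?ln_exp //; exact: exp_pos.
have hP := @prob_first_moment n p s k (120 * k) (@good_event 3 n conn k) _ s01 _.
have {}hP := hP ltac:(lra).
have {}hP : prob p (@good_event 3 n conn k) * s ^ (120 * k) <=
    INR 'C(n, k) * (1 - p + s * p) ^ 'C(k, 2%N).
  by apply: hP => G [W [Wk [/diameter_graph_size hW _]]]; exists W; rewrite // -Wk.
have hC : INR 'C(n, k) <= exp (K * (1 + x)).
  rewrite -expk exp_plus; apply: bin_le => //; first by apply: Rlt_le; exact: exp_pos.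
  rewrite exp_ln; last by apply: Rmult_lt_0_compat; lra.
  rewrite -/K.
  (* This yields n <= K (np), so [bin_le] applies with y = np = exp x. *)
  have : 1 <= K * p.
    have p2x : l <= p * (2 * x).
      apply: (Rle_trans _ (p * / q)); last by apply: Rmult_le_compat_l; lra.
      apply: (Rmult_le_reg_r q) => //; rewrite Rmult_assoc Rinv_l; lra.
    have : 2 * x < K * (p * (2 * x)) by have := Rmult_le_compat_l K _ _ ltac:(lra) p2x; nra.
    by nra.
  by nra.
have hS : exp (- L * (120 * K)) <= s ^ (120 * k).
  have -> : - L * (120 * K) = INR (120 * k)%N * (- L).
    rewrite -multE mult_INR -/K (_ : INR 120 = 120); first ring.
    by rewrite INR_IZR_INZ.
  by rewrite -expk; apply: pow_incr; split=> //; apply: Rlt_le; exact: exp_pos.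
have hB : (1 - p + s * p) ^ 'C(k, 2%N) <= exp (K * (K - 1) / 2 * - ((1 - d) * l)).
  rewrite -INR_bin2 -expk; apply: pow_incr; split=> //.
  by have := Rmult_lt_0_compat s p; lra.
set P := prob p _ in hP *.
apply: Rnot_lt_le => hlt.
have PS : P * exp (- L * (120 * K)) <= P * s ^ (120 * k) by apply: Rmult_le_compat_l; lra.
have CB : INR 'C(n, k) * (1 - p + s * p) ^ 'C(k, 2%N) <=
    exp (K * (1 + x)) * exp (K * (K - 1) / 2 * - ((1 - d) * l)).
  apply: Rmult_le_compat => //; first exact: pos_INR.
  by apply: pow_le; have := Rmult_lt_0_compat s p; lra.
have : P <= exp (K * (1 + x) + K * (K - 1) / 2 * - ((1 - d) * l) + L * (120 * K)).
  apply: (Rmult_le_reg_r (exp (- L * (120 * K)))); first exact: exp_pos.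
  rewrite -exp_plus.
  have -> : K * (1 + x) + K * (K - 1) / 2 * - ((1 - d) * l) + L * (120 * K) + - L * (120 * K)
    = K * (1 + x) + K * (K - 1) / 2 * - ((1 - d) * l) by ring.
  by rewrite exp_plus; lra.
(* Per vertex, 1 + x comes from choosing the set and 120 L from the permitted edges. Replacing K - 1
   by K costs at most L / 2, as l <= L; hence the 121 in the hypothesis. *)
have : K * (1 + x) + K * (K - 1) / 2 * - ((1 - d) * l) + L * (120 * K) <= -1.
  have -> : K * (1 + x) + K * (K - 1) / 2 * - ((1 - d) * l) + L * (120 * K)
    = K * (1 + x - (1 - d) * (K * l - l) / 2 + 120 * L) by field.
  have : (1 - d) * (K * l - l) >= (1 - d) * ((2 + eps) * x - L) by nra.
  have : (1 - d) * ((2 + eps) * x - L) >= 2 * (1 + eps / 4) * x - L.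
    by rewrite -dE; nra.
  by nra.
move=> h1 h2.
have : exp (-1) < / 2.
  have e2 : 2 < exp 1 by have := exp_ineq1 1 ltac:(lra); lra.
  by rewrite (_ : -1 = - (1)) ?exp_Ropp; [apply: Rinv_lt_contravar; lra|lra].
have : exp (K * (1 + x) + K * (K - 1) / 2 * - ((1 - d) * l) + L * (120 * K)) <= exp (-1).
  by case: h1 => [/exp_increasing|->]; lra.
lra.
Qed.

Lemma u_gen_le conn d n (p B : R) : 0 <= B ->
  (forall k, (0 < k)%N -> B < INR k -> prob p (@good_event d n conn k) <= / 2) ->
  INR (u_gen conn d n p) <= B.
Proof.
move=> B0 h; rewrite /u_gen; apply: (big_ind (fun k => INR k <= B)) => //.
  by move=> k l hk hl; case: (leqP k l).
move=> k /pbP[k0 hk]; apply: Rnot_lt_le => /(h _ k0); lra.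
Qed.

Theorem theorem21 (p : nat -> R)
  (hp : forall n : nat, Rle 0 (p n) /\ Rle (p n) 1)
  (hpn : cv_infty (fun n : nat => Rmult (INR n) (p n)))
  (hq : cv_infty (fun n : nat => Rmult (Rminus 1 (p n)) (ln (INR n)))) :
  forall eps : R, Rlt 0 eps ->
  exists n0 : nat, forall n : nat, (n0 <= n)%N ->
    Rle (INR (u 3 n (p n)))
        (Rmult (Rplus 2 eps) (logb (Rinv (Rminus 1 (p n))) (Rmult (INR n) (p n)))) /\
    Rle (INR (u' 3 n (p n)))
        (Rmult (Rplus 2 eps) (logb (Rinv (Rminus 1 (p n))) (Rmult (INR n) (p n)))).
Proof.
move=> eps eps0.
have d0 : 0 < eps / (4 + 2 * eps) by apply: Rdiv_lt_0_compat; lra.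
have b0 : 0 < 121 by lra.
have c0 : 0 < eps / 4 by lra.
have [X hX] := log_linear_bound b0 c0 d0.
have [N1 hN1] := hpn (exp (Rmax 1 X)).
have [N2 hN2] := hq 1.
exists (maxn N1 N2) => n; rewrite geq_max => /andP[/leP/hN1 np /leP/hN2 qn].
set r := p n in np qn *; have [r0 r1] := hp n; rewrite -/r in r0 r1.
have np0 : 0 < INR n * r by have := exp_pos (Rmax 1 X); lra.
have n0 : 0 < INR n.
  by case: (pos_INR n) => // e; rewrite -e Rmult_0_l in np0; lra.
have rp : 0 < r by case: r0 => // e; rewrite -e Rmult_0_r in np0; lra.
(* At r = 1 the quantity q ln n would be 0, but it exceeds 1. *)
have rl : r < 1.
  by case: r1 => // e; rewrite e Rminus_diag Rmult_0_l in qn; lra.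
set x := ln (INR n * r).
have xX : Rmax 1 X <= x.
  by rewrite /x -[Rmax 1 X]ln_exp; apply: Rlt_le; apply: ln_increasing => //; exact: exp_pos.
have x1 : 1 <= x := Rle_trans _ _ _ (Rmax_l 1 X) xX.
have xX' : X <= x := Rle_trans _ _ _ (Rmax_r 1 X) xX.
have q_inv : / (1 - r) <= 2 * x.
  apply: (Rmult_le_reg_l (1 - r)); first lra.
  rewrite Rinv_r; last lra.
  (* For r <= 1/2, 1/q <= 2 <= 2x. Otherwise ln n <= x + ln 2 <= 2x, and q ln n > 1 gives 1/q < ln
     n. *)
  case: (Rle_lt_dec r (/ 2)) => half; first by nra.
  have : ln (INR n) <= ln (INR n * r) + ln 2.
    rewrite -ln_mult; [|lra|lra].
    by apply: Rnot_lt_le => /ln_lt_inv lt; have := lt ltac:(nra) n0; nra.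
  have := ln_lt_2; have : ln 2 <= 1 by have := exp_ineq1_le (ln 2); rewrite exp_ln; lra.
  rewrite -/x => *; apply: (Rle_trans _ ((1 - r) * ln (INR n))); first lra.
  by apply: Rmult_le_compat_l; lra.
have l0 : 0 < ln (/ (1 - r)).
  by rewrite -ln_1; apply: ln_increasing; [lra|rewrite -Rinv_1; apply: Rinv_lt_contravar; lra].
suff bound conn : INR (u_gen conn 3 n r) <= (2 + eps) * logb (/ (1 - r)) (INR n * r).
  by split; exact: bound.
rewrite /logb -/x.
have E : (2 + eps) * (x / ln (/ (1 - r))) * ln (/ (1 - r)) = (2 + eps) * x by field; lra.
apply: u_gen_le => [|k k0 hk].
  by apply: Rmult_le_pos; [lra|apply: Rlt_le; apply: Rdiv_lt_0_compat; lra].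
apply: (@prob_good_event_le n k conn r eps) => //; first by have := hX _ xX'; rewrite -/x; lra.
by rewrite -/x -E; apply: Rmult_lt_compat_r.
Qed.
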